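(* Let $\alpha\in(1,2)$ and let $d:[x_L,x_R]\to\mathbb{R}$ satisfy $0<d_-\le d(x)\le d_+<\infty$. Let $u(x,t)$ be the exact solution of $$\frac{\partial u(x,t)}{\partial t}=d(x)\,{}_{x_L}D_x^{\alpha}u(x,t)+f(x,t),\quad x\in(x_L,x_R),\ t\in(0,T],$$ with $u(x_L,t)=u(x_R,t)=0$ for $t\in[0,T]$ and $u(x,0)=\varphi(x)$ for $x\in[x_L,x_R]$. Assume there is a constant $c_1>0$, independent of $i,n,\tau,h$, such that the truncation errors $$R_i^{n-\frac12}:=\frac{u(x_i,t_n)-u(x_i,t_{n-1})}{\tau}-\frac{d(x_i)}{2h^\alpha}\sum_{k=0}^{i}w_k^{(\alpha)}\left(u(x_{i-k+1},t_{n-1})+u(x_{i-k+1},t_n)\right)-f(x_i,t_{n-\frac12})$$ satisfy $|R_i^{n-\frac12}|\le c_1(\tau^2+h^2)$ for $1\le i\le M$, $1\le n\le N$. Let $u^n=(u_1^n,\dots,u_M^n)^T$ be the solution of the finite difference scheme $$\frac1{\tau}\left(u^{n}-u^{n-1}\right)=\frac{1}{2h^\alpha}DG_\alpha\left(u^{n-1}+u^{n}\right)+f^{n-\frac12},\quad n=1,\dots,N,$$ with $u_i^0=\varphi(x_i)$ and $u_0^n=u_{M+1}^n=0$. Put $e_i^n=u(x_i,t_n)-u_i^n$ for $0\le i\le M+1$, $0\le n\le N$, and $e^n=(e_1^n,\dots,e_M^n)^T$. Then there exists a positive constant $c_2$, independent of $\tau$, $h$ and $n$, such that $$\|e^n\|\le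 c_2(\tau^2+h^2),\qquad 0\le n\le N.$$
   Context: Let $x_L<x_R$, $T>0$, $M,N$ positive integers, $h=(x_R-x_L)/(M+1)$, $\tau=T/N$, $x_i=x_L+ih$, $t_n=n\tau$, $t_{n-\frac12}=(t_{n-1}+t_n)/2$. The Riemann–Liouville derivative is ${}_{x_L}D_x^{\alpha}u(x,t)=\frac{1}{\Gamma(2-\alpha)}\frac{\partial^2}{\partial x^2}\int_{x_L}^x\frac{u(\xi,t)}{(x-\xi)^{\alpha-1}}\,d\xi$. Define $g_0^{(\alpha)}=1$, $g_k^{(\alpha)}=\left(1-\frac{\alpha+1}{k}\right)g_{k-1}^{(\alpha)}$ for $k\ge1$, and $w_0^{(\alpha)}=\frac{\alpha}{2}g_0^{(\alpha)}$, $w_k^{(\alpha)}=\frac{\alpha}{2}g_k^{(\alpha)}+\frac{2-\alpha}{2}g_{k-1}^{(\alpha)}$ for $k\ge1$. $G_\alpha\in\mathbb{R}^{M\times M}$ is the Toeplitz matrix whose $(i,j)$ entry is $w_{i-j+1}^{(\alpha)}$ if $i-j+1\ge0$ and $0$ otherwise. $D=\mathrm{diag}(d(x_1),\dots,d(x_M))$, $f^{n-\frac12}=(f(x_1,t_{n-\frac12}),\dots,f(x_M,t_{n-\frac12}))^T$. The discrete $L^2$ norm is $\|v\|=\sqrt{h\,v^Tv}$ for $v\in\mathbb{R}^M$. *)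

(* Defs.v *)
From HB Require Import structures.
From mathcomp Require Import all_boot all_order all_algebra.
From mathcomp Require Import all_classical all_reals all_analysis.

Set Implicit Arguments.
Unset Strict Implicit.
Unset Printing Implicit Defensive.

Import Order.TTheory GRing.Theory Num.Theory.
Import numFieldNormedType.Exports.

Local Open Scope classical_set_scope.
Local Open Scope ring_scope.

(* Functions on [xL, xR], on [xL, xR] x [0, T] and on the grid are represented
   by total functions; their values outside of these domains are never used. *)

Section RiemannLiouville.
Variable R : realType.

Definition Gamma (s : R) : R :=
  \int[lebesgue_measure]_(t in `]0, +oo[) (t `^ (s - 1) * expR (- t)).

Definition rl_kernel (alpha : R) (v : R -> R) (x xi : R) : R :=
  v xi / (x - xi) `^ (alpha - 1).

Definition rl_integral (xL alpha : R) (v : R -> R) (x : R) : R :=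
  \int[lebesgue_measure]_(xi in `[xL, x]) rl_kernel alpha v x xi.

(* [Rintegral] and [derive1n] are total: this predicate states that the
   integrals converge near x and that the second derivative exists at x. *)
Definition rl_derivable (xL alpha : R) (v : R -> R) (x : R) : Prop :=
  [/\ \forall y \near x, (@lebesgue_measure R).-integrable `[xL, y]
        (fun xi => (rl_kernel alpha v y xi)%:E),
      \forall y \near x, derivable (rl_integral xL alpha v) y 1 &
      derivable (derive1 (rl_integral xL alpha v)) x 1].

Definition rl_derivative (xL alpha : R) (v : R -> R) (x : R) : R :=
  (Gamma (2 - alpha))^-1 * derive1n 2 (rl_integral xL alpha v) x.

(* Derivative of g at t relative to A: one-sided at an endpoint of A. *)
Definition is_derive_within (A : set R) (g : R -> R) (t l : R) : Prop :=
  (g s - g t) / (s - t) @[s --> within A t^'] --> l.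

Definition exact_solution (xL xR T alpha : R) (d : R -> R) (f u : R -> R -> R)
    (phi : R -> R) : Prop :=
  [/\ forall x t : R, xL < x < xR -> 0 < t <= T ->
        rl_derivable xL alpha (u ^~ t) x /\
        is_derive_within `[0, T] (u x) t
          (d x * rl_derivative xL alpha (u ^~ t) x + f x t),
      forall t : R, 0 <= t <= T -> u xL t = 0 /\ u xR t = 0 &
      forall x : R, xL <= x <= xR -> u x 0 = phi x].

End RiemannLiouville.

Section Scheme.
Variable R : realType.

Fixpoint g_coef (alpha : R) (k : nat) : R :=
  if k is k'.+1 then (1 - (alpha + 1) / k%:R) * g_coef alpha k' else 1.

Definition w_coef (alpha : R) (k : nat) : R :=
  if k is k'.+1
  then alpha / 2 * g_coef alpha k + (2 - alpha) / 2 * g_coef alpha k'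
  else alpha / 2 * g_coef alpha 0.

Definition hstep (xL xR : R) (M : nat) : R := (xR - xL) / M.+1%:R.
Definition tstep (T : R) (N : nat) : R := T / N%:R.
Definition xgrid (xL xR : R) (M i : nat) : R := xL + i%:R * hstep xL xR M.
Definition tgrid (T : R) (N n : nat) : R := n%:R * tstep T N.

(* The midpoint t_{n - 1/2}, for 1 <= n. *)
Definition tmid (T : R) (N n : nat) : R := (tgrid T N n.-1 + tgrid T N n) / 2.

(* R_i^{n - 1/2}, for 1 <= i <= M and 1 <= n <= N. *)
Definition trunc_error (xL xR T alpha : R) (d : R -> R) (f u : R -> R -> R)
    (M N i n : nat) : R :=
  let x := xgrid xL xR M in
  let t := tgrid T N in
  (u (x i) (t n) - u (x i) (t n.-1)) / tstep T N
  - d (x i) / (2 * hstep xL xR M `^ alpha) *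
      (\sum_(0 <= k < i.+1) w_coef alpha k *
         (u (x (i.+1 - k)%N) (t n.-1) + u (x (i.+1 - k)%N) (t n)))
  - f (x i) (tmid T N n).

(* Vector of the values of a grid function at the interior nodes 1, ..., M:
   its entry of (0-based) index i is the value at node i + 1. *)
Definition interior_vec (M : nat) (v : nat -> R) : 'cV[R]_M :=
  \col_(i < M) v i.+1.

Definition Gmx (alpha : R) (M : nat) : 'M[R]_M :=
  \matrix_(i < M, j < M)
    if (j <= i.+1)%N then w_coef alpha (i.+1 - j) else 0.

Definition Dmx (xL xR : R) (d : R -> R) (M : nat) : 'M[R]_M :=
  diag_mx (\row_(i < M) d (xgrid xL xR M i.+1)).

Definition fvec (xL xR T : R) (f : R -> R -> R) (M N n : nat) : 'cV[R]_M :=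
  interior_vec M (fun i => f (xgrid xL xR M i) (tmid T N n)).

(* U n i stands for u_i^n. *)
Definition scheme_solution (xL xR T alpha : R) (d : R -> R) (f : R -> R -> R)
    (phi : R -> R) (M N : nat) (U : nat -> nat -> R) : Prop :=
  [/\ forall n, (1 <= n <= N)%N ->
        (tstep T N)^-1 *: (interior_vec M (U n) - interior_vec M (U n.-1)) =
        (2 * hstep xL xR M `^ alpha)^-1 *:
          (Dmx xL xR d M *m Gmx alpha M *m
             (interior_vec M (U n.-1) + interior_vec M (U n)))
        + fvec xL xR T f M N n,
      forall i, (i <= M.+1)%N -> U 0%N i = phi (xgrid xL xR M i) &
      forall n, (n <= N)%N -> U n 0%N = 0 /\ U n M.+1 = 0].

Definition grid_error (xL xR T : R) (u : R -> R -> R) (M N : nat)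
    (U : nat -> nat -> R) (n i : nat) : R :=
  u (xgrid xL xR M i) (tgrid T N n) - U n i.

Definition dnorm (h : R) (M : nat) (v : 'cV[R]_M) : R :=
  Num.sqrt (h * (v^T *m v) 0 0).

End Scheme.

(* Main.v *)
Require Import Defs.
From mathcomp Require Import all_boot all_order all_algebra.
From mathcomp Require Import all_classical all_reals all_analysis.
From mathcomp Require Import ring lra.
Import Order.TTheory GRing.Theory Num.Theory.
Import numFieldNormedType.Exports.
Local Open Scope ring_scope.

(** The proof is an energy estimate in the inner product weighted by 1/d, in
    which the factor D of the scheme disappears.

    The error satisfies the scheme itself, with the truncation error R^n as its
    source: (e^n - e^(n-1)) / tau = kappa D G s + R^n, where s = e^(n-1) + e^n
    and kappa = 1 / (2 h^alpha), and it starts from e^0 = 0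
    ([grid_error_step]).  Taking the weighted product with s, the left side
    becomes (|e^n|^2 - |e^(n-1)|^2) / tau, and the diffusion term becomes
    kappa s^T G s.  If s^T G s <= 0, Cauchy-Schwarz bounds the right side by
    (|e^n| + |e^(n-1)|) |R^n|, and division by |e^n| + |e^(n-1)| leaves
    |e^n| <= |e^(n-1)| + tau |R^n| ([crank_nicolson_stable]).  Summing over at
    most N = T / tau steps gives |e^n| <= T max |R^k|, and the bounds
    dm <= d <= dp convert between the weighted and the discrete L^2 norms.

    The one property of the difference operator that matters is therefore
    s^T G s <= 0 ([Gmx_le0]).  It holds because G + G^T is a Toeplitz matrix
    with nonnegative entries off the diagonal and nonpositive row sums.  The
    entries at distance 1 from the diagonal are w_0 + w_2 =
    alpha (alpha + 2) (alpha - 1) / 4, those at distance m >= 2 are w_(m+1),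
    and the row sums are controlled by the partial sums of the w_k, which are
    nonpositive from k = 2 on. *)

(** * Weighted inner products *)

Section WeightedNorm.
Variables (R : rcfType) (M : nat) (p : 'I_M -> R).

Definition wdot (x y : 'cV[R]_M) : R := \sum_i p i * (x i 0 * y i 0).

Definition wnorm (x : 'cV[R]_M) : R := Num.sqrt (wdot x x).

Lemma wdotDl x y z : wdot (x + y) z = wdot x z + wdot y z.
Proof. by rewrite -big_split; apply: eq_bigr => i _ /=; rewrite !mxE; ring. Qed.

Lemma wdotC x y : wdot x y = wdot y x.
Proof. by apply: eq_bigr => i _; rewrite [y i 0 * _]mulrC. Qed.

Lemma wdotZl a x y : wdot (a *: x) y = a * wdot x y.
Proof. by rewrite mulr_sumr; apply: eq_bigr => i _; rewrite !mxE; ring. Qed.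

Lemma wdotDr x y z : wdot x (y + z) = wdot x y + wdot x z.
Proof. by rewrite wdotC wdotDl !(wdotC _ x). Qed.

Lemma wdotZr a x y : wdot x (a *: y) = a * wdot x y.
Proof. by rewrite wdotC wdotZl wdotC. Qed.

Hypothesis p_gt0 : forall i, 0 < p i.

Lemma wdot_ge0 x : 0 <= wdot x x.
Proof.
apply: sumr_ge0 => i _.
by rewrite mulr_ge0 ?(ltW (p_gt0 i)) // -expr2 sqr_ge0.
Qed.

Lemma sqr_wnorm x : wnorm x ^+ 2 = wdot x x.
Proof. by rewrite sqr_sqrtr ?wdot_ge0. Qed.

Lemma wdot_eq0 x : wdot x x = 0 -> x = 0.
Proof.
move=> /eqP; rewrite psumr_eq0 => [/allP x0|i _]; last first.
  by rewrite mulr_ge0 ?(ltW (p_gt0 i)) // -expr2 sqr_ge0.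
apply/matrixP => i j; rewrite (ord1 j) mxE.
have := x0 i (mem_index_enum i).
by rewrite /= mulf_eq0 gt_eqF //= -expr2 sqrf_eq0 => /eqP.
Qed.

Lemma wdot_CauchySchwarz x y : wdot x y <= wnorm x * wnorm y.
Proof.
have [/wdot_eq0 ->|y0] := eqVneq (wdot y y) 0.
  by rewrite -(scale0r 0) wdotZr mul0r mulr_ge0 ?sqrtr_ge0.
have yy_gt0 : 0 < wdot y y by rewrite lt0r y0 wdot_ge0.
rewrite (le_trans (ler_norm _)) // -sqrtr_sqr -sqrtrM ?wdot_ge0 //.
rewrite ler_sqrt ?mulr_ge0 ?wdot_ge0 //.
(* A multiple of the component of x orthogonal to y; scaling by wdot y y
   avoids the division. *)
have := wdot_ge0 (wdot y y *: x + (- wdot x y) *: y).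
rewrite !(wdotDl, wdotDr, wdotZl, wdotZr) (wdotC y x) => h.
rewrite -subr_ge0 -(pmulr_rge0 _ yy_gt0).
by move: h; congr (0 <= _); ring.
Qed.

End WeightedNorm.

Arguments wdot {R M} p x y.
Arguments wnorm {R M} p x.
Arguments wdot_CauchySchwarz {R M p} p_gt0 x y.

(** * Dissipative matrices and stability of the Crank-Nicolson step *)

(** Diagonal dominance of the symmetric part: with b = A + A^T, the inequality
    v_i v_j <= (v_i^2 + v_j^2) / 2 may be used in every term b_ij v_i v_j, as
    b_ij >= 0 for i != j and as it is an equality for i = j.  What remains is
    the sum over i of v_i^2 times the i-th row sum of b. *)
Lemma quad_form_le0 (R : realFieldType) (M : nat) (A : 'M[R]_M) :
  (forall i j, i != j -> 0 <= A i j + A j i) ->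
  (forall i, \sum_j (A i j + A j i) <= 0) ->
  forall v : 'cV[R]_M, (v^T *m A *m v) 0 0 <= 0.
Proof.
move=> offdiag rowsum v.
have -> : (v^T *m A *m v) 0 0 = \sum_i \sum_j A i j * (v i 0 * v j 0).
  rewrite mxE exchange_big; apply: eq_bigr => j _.
  by rewrite mxE mulr_suml; apply: eq_bigr => i _; rewrite !mxE; ring.
set q := \sum_i _.
have q2 : q *+ 2 = \sum_i \sum_j (A i j + A j i) * (v i 0 * v j 0).
  rewrite mulr2n {1}/q exchange_big /= /q -big_split; apply: eq_bigr => i _.
  by rewrite -big_split; apply: eq_bigr => j _ /=; ring.
(* By symmetry of A + A^T, the v_j^2 contribute as much as the v_i^2. *)
have swap : \sum_i \sum_j (A i j + A j i) * v j 0 ^+ 2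
    = \sum_i \sum_j (A i j + A j i) * v i 0 ^+ 2.
  rewrite exchange_big /=; apply: eq_bigr => i _; apply: eq_bigr => j _.
  by rewrite addrC.
have q4 : q *+ 2 *+ 2 <= (\sum_i \sum_j (A i j + A j i) * v i 0 ^+ 2) *+ 2.
  rewrite [leRHS]mulr2n -{1}swap q2 -sumrMnl -big_split; apply: ler_sum => i _.
  rewrite -sumrMnl -big_split; apply: ler_sum => j _ /=.
  have [->|/offdiag Aij] := eqVneq i j; first by rewrite -expr2 mulr2n.
  rewrite -subr_ge0; have := mulr_ge0 Aij (sqr_ge0 (v i 0 - v j 0)).
  by congr (0 <= _); ring.
suff : \sum_i \sum_j (A i j + A j i) * v i 0 ^+ 2 <= 0 by lra.
apply: sumr_le0 => i _; rewrite -mulr_suml.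
by rewrite mulr_le0_ge0 ?sqr_ge0.
Qed.

(** Testing the step against e0 + e1 with the weights 1/d turns
    diag(d) A into A and the increment into the difference of the squared
    norms, so that a dissipative A can only help. *)
Lemma crank_nicolson_stable (R : rcfType) (M : nat) (A : 'M[R]_M)
    (d : 'rV[R]_M) (tau kappa : R) (e0 e1 r : 'cV[R]_M) :
  (forall v : 'cV[R]_M, (v^T *m A *m v) 0 0 <= 0) ->
  (forall i, 0 < d 0 i) -> 0 <= tau -> 0 <= kappa ->
  e1 - e0 = tau *: (kappa *: (diag_mx d *m A *m (e0 + e1)) + r) ->
  wnorm (fun i => (d 0 i)^-1) e1 <=
    wnorm (fun i => (d 0 i)^-1) e0 + tau * wnorm (fun i => (d 0 i)^-1) r.
Proof.
move=> A_le0 d_gt0 tau_ge0 kappa_ge0 step; set p := fun i => (d 0 i)^-1.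
have p_gt0 i : 0 < p i by rewrite invr_gt0.
set a := wnorm p e1; set b := wnorm p e0; set c := wnorm p r.
have [a_ge0 b_ge0 c_ge0] : [/\ 0 <= a, 0 <= b & 0 <= c] by rewrite !sqrtr_ge0.
have weight x : wdot p x (diag_mx d *m A *m x) = (x^T *m A *m x) 0 0.
  rewrite -[x^T *m A *m x]mulmxA mxE; apply: eq_bigr => i _.
  rewrite -mulmxA mul_diag_mx !mxE /p; field.
  by rewrite gt_eqF.
have energy : a ^+ 2 - b ^+ 2 = wdot p (e0 + e1) (e1 - e0).
  rewrite -(scaleN1r e0) !sqr_wnorm // !(wdotDl, wdotDr, wdotZr).
  by rewrite (wdotC _ _ _ e1 e0); ring.
have : a ^+ 2 - b ^+ 2 <= (a + b) * (tau * c).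
  rewrite energy step wdotZr wdotDr wdotZr weight wdotDl mulrCA.
  apply: ler_wpM2l => //; rewrite mulrDl.
  have ha := wdot_CauchySchwarz p_gt0 e1 r.
  have hb := wdot_CauchySchwarz p_gt0 e0 r.
  have := mulr_ge0_le0 kappa_ge0 (A_le0 (e0 + e1)).
  by move: ha hb; rewrite -/a -/b -/c; lra.
rewrite subr_sqr [(a - b) * _]mulrC.
(* If a + b = 0, both norms vanish and there is nothing to divide by. *)
have [ab_gt0|ab_le0 _] := ltrP 0 (a + b).
  by rewrite ler_pM2l // lerBlDl.
have : 0 <= tau * c by rewrite mulr_ge0.
lra.
Qed.

Arguments crank_nicolson_stable {R M A d tau kappa e0 e1 r}.

(** * The weighted and shifted Gruenwald coefficients *)

Section Coefficients.
Variables (R : realType) (alpha : R).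
Hypothesis alpha12 : 1 < alpha < 2.
Local Notation g := (g_coef alpha).
Local Notation w := (w_coef alpha).

Lemma g_coef_ge0 k : 0 <= g k.+2.
Proof.
have /andP[a1 a2] := alpha12; elim: k => [|k IH].
  have -> : g 2 = alpha * (alpha - 1) / 2 by rewrite /=; field.
  by rewrite divr_ge0 // mulr_ge0 ?subr_ge0 ?ltW // (lt_trans _ a1).
rewrite [g _]/(_ * g k.+2) mulr_ge0 // subr_ge0 ler_pdivrMr // mul1r.
by have : (0 : R) <= k%:R := ler0n _ _; rewrite -natr1 -natr1 -natr1; lra.
Qed.

(** Partial sums of the binomial series of (1 - z)^alpha at z = 1 in closed
    form; their sign can then be read off from that of the next coefficient. *)
Lemma sum_g_coef n : alpha * (\sum_(k < n.+1) g k) = - (n.+1%:R * g n.+1).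
Proof.
have gS k : g k.+1 = (1 - (alpha + 1) / k.+1%:R) * g k by [].
elim: n => [|n IH]; first by rewrite big_ord1 /=; field.
rewrite big_ord_recr mulrDr IH (gS n.+1) -[n.+2%:R]natr1.
by field; rewrite nat1r natr1 pnatr_eq0.
Qed.

Lemma sum_g_coef_le0 n : \sum_(k < n.+2) g k <= 0.
Proof.
have /andP[a1 _] := alpha12; have a_gt0 : 0 < alpha by apply: lt_trans a1.
rewrite -(pmulr_rle0 _ a_gt0) sum_g_coef oppr_le0.
by rewrite mulr_ge0 ?g_coef_ge0.
Qed.

Lemma sum_w_coef n : \sum_(k < n.+2) w k
  = alpha / 2 * \sum_(k < n.+2) g k + (2 - alpha) / 2 * \sum_(k < n.+1) g k.
Proof.
rewrite big_ord_recl [\sum_(k < n.+2) g k]big_ord_recl mulrDr -addrA.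
congr (_ + _).
by rewrite !mulr_sumr -big_split.
Qed.

(** The sum must reach k = 2: w 0 + w 1 = (2 - alpha ^+ 2) / 2 is positive for
    alpha < sqrt 2. *)
Lemma sum_w_coef_le0 n : \sum_(k < n.+3) w k <= 0.
Proof.
have /andP[a1 a2] := alpha12.
rewrite sum_w_coef -oppr_ge0 opprD -!mulrN.
by rewrite addr_ge0 // mulr_ge0 ?oppr_ge0 ?sum_g_coef_le0 //; lra.
Qed.

Lemma w_coef_ge0 k : 0 <= w k.+3.
Proof.
have /andP[a1 a2] := alpha12.
by apply: addr_ge0; apply: mulr_ge0; rewrite ?g_coef_ge0 //; lra.
Qed.

Lemma w_coef1_le0 : w 1 <= 0.
Proof.
have /andP[a1 a2] := alpha12.
have -> : w 1 = (1 - alpha) * (alpha + 2) / 2 by rewrite /=; field.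
by rewrite pmulr_lle0 // mulr_le0_ge0; lra.
Qed.

Lemma w_coef02_ge0 : 0 <= w 0 + w 2.
Proof.
have /andP[a1 a2] := alpha12.
have -> : w 0 + w 2 = alpha * (alpha + 2) * (alpha - 1) / 4 by rewrite /=; field.
by rewrite !mulr_ge0 //; lra.
Qed.

(** The off-diagonal entries of G + G^T, as a function of the distance m >= 1
    to the diagonal: w 0 sits on the first superdiagonal of G, so that it
    contributes at distance 1 only. *)
Definition w_sym (m : nat) : R := if m == 1%N then w 0 + w 2 else w m.+1.

Lemma w_sym_ge0 m : 0 <= w_sym m.+1.
Proof. by case: m => [|m]; [exact: w_coef02_ge0 | exact: w_coef_ge0]. Qed.

(** These are the entries of a row of G + G^T on one side of the diagonal.  How
    many there are depends on the row, so the bound has to be uniform in n. *)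
Lemma sum_w_sym_le n : \sum_(m < n) w_sym m.+1 <= - w 1.
Proof.
(* The sum and w 1 make up the first n.+3 coefficients, except that an empty
   sum lacks w 0 + w 2. *)
case: n => [|n]; first by rewrite big_ord0 oppr_ge0 w_coef1_le0.
have tail : \sum_(i < n) w_sym (lift ord0 i).+1
    = \sum_(i < n) w (lift ord0 (lift ord0 (lift ord0 i))) by [].
have w_sym1 : w_sym (@ord0 n).+1 = w 0 + w 2 by [].
rewrite big_ord_recl tail w_sym1 -subr_le0 opprK.
apply: le_trans (sum_w_coef_le0 n); rewrite !big_ord_recl.
have -> : w (@lift n.+3 ord0 ord0) = w 1 by [].
have -> : w (@lift n.+3 ord0 (lift ord0 ord0)) = w 2 by [].
by rewrite le_eqVlt; apply/orP; left; apply/eqP; ring.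
Qed.

Lemma Gmx_sym M (i j : 'I_M) : (i < j)%N ->
  Gmx alpha M i j + Gmx alpha M j i = w_sym (j - i).
Proof.
move=> ij; rewrite !mxE (leq_trans (ltnW ij)) // /w_sym (subSn (ltnW ij)).
have [ji|ij1] := leqP j i.+1.
  have -> : j = i.+1 :> nat by apply/eqP; rewrite eqn_leq ji.
  by rewrite subnn subSnn eqxx.
by rewrite add0r ifF // gtn_eqF // ltn_subRL addn1.
Qed.

(** The two sides of the diagonal contribute at most - w 1 each to a row sum of
    G + G^T, which the diagonal entry 2 w_1 compensates. *)
Lemma Gmx_le0 M (v : 'cV[R]_M) : (v^T *m Gmx alpha M *m v) 0 0 <= 0.
Proof.
have sym_ge0 (i j : 'I_M) : (i < j)%N -> 0 <= Gmx alpha M i j + Gmx alpha M j i.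
  by move=> ij; rewrite Gmx_sym // -(subnSK ij) w_sym_ge0.
apply: quad_form_le0 => [i j|i].
  by rewrite neq_ltn => /orP[/sym_ge0//|/sym_ge0]; rewrite addrC.
pose row j := if (j < i)%N then w_sym (i - j) else
  if (i < j)%N then w_sym (j - i) else w 1 *+ 2.
rewrite (eq_bigr (fun j : 'I_M => row j)) => [|j _]; last first.
  rewrite /row; case: ltngtP => [ji|ij|/val_inj <-].
  - by rewrite addrC Gmx_sym.
  - by rewrite Gmx_sym.
  - by rewrite mxE leqnSn subSnn mulr2n.
rewrite -(big_mkord xpredT row) (big_cat_nat (n := i)) ?(ltnW (ltn_ord i)) //=.
rewrite [X in _ + X]big_ltn // {2}/row ltnn mulr2n.
have -> : \sum_(0 <= j < i) row j = \sum_(m < i) w_sym m.+1.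
  rewrite big_nat_rev big_mkord; apply: eq_bigr => m _.
  rewrite /row add0n ifT ?ltn_subrL ?(leq_ltn_trans _ (ltn_ord m)) //.
  by rewrite subKn.
have -> : \sum_(i.+1 <= j < M) row j = \sum_(m < M - i.+1) w_sym m.+1.
  rewrite -[i.+1]add0n big_addn add0n big_mkord; apply: eq_bigr => m _.
  have im : (i < m + i.+1)%N by rewrite addnS ltnS leq_addl.
  by rewrite /row im ltnNge (ltnW im) /= addnS -addSn addnK.
have := sum_w_sym_le i; have := sum_w_sym_le (M - i.+1); lra.
Qed.

(** The convolution at node i uses nodes 1 to i + 1, which for i = M includes
    the right endpoint; the matrix has no column for it, hence the boundary
    condition. *)
Lemma Gmx_mul M (s : nat -> R) (i : 'I_M) : s M.+1 = 0 ->
  (Gmx alpha M *m interior_vec M s) i 0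
  = \sum_(0 <= k < i.+2) w k * s (i.+2 - k)%N.
Proof.
move=> sM; pose F j := (if (j <= i.+1)%N then w (i.+1 - j) else 0) * s j.+1.
rewrite mxE (eq_bigr (fun j : 'I_M => F j)) => [|j _]; last by rewrite !mxE.
have -> : \sum_(j < M) F j = \sum_(j < M.+1) F j.
  by rewrite big_ord_recr /= {3}/F sM mulr0 addr0.
have above_diag : \sum_(i.+2 <= j < M.+1) F j = 0.
  rewrite big_nat_cond big1 // => j.
  by rewrite andbT => /andP[ij _]; rewrite /F leqNgt ij mul0r.
rewrite -(big_mkord xpredT F) (big_cat_nat (n := i.+2)) ?ltnS //= above_diag addr0.
rewrite big_nat_rev !big_mkord; apply: eq_bigr => k _.
have ki : (k <= i.+1)%N by rewrite -ltnS.
by rewrite /F add0n subSS leq_subr subKn // (subSn ki).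
Qed.

End Coefficients.

Arguments Gmx_le0 {R alpha} alpha12 {M} v.

(** * The error equation and convergence *)

Lemma dnorm_le_wnorm (R : realType) (M : nat) (h b : R) (p : 'I_M -> R)
    (v : 'cV[R]_M) :
  0 <= h -> 0 < b -> (forall i, b^-1 <= p i) ->
  dnorm h v <= Num.sqrt (h * b) * wnorm p v.
Proof.
move=> h_ge0 b_gt0 hp; have hb := mulr_ge0 h_ge0 (ltW b_gt0).
have p_ge0 i : 0 <= p i by apply: le_trans (hp i); rewrite invr_ge0 ltW.
rewrite -sqrtrM // ler_wsqrtr // -mulrA ler_wpM2l // mxE mulr_sumr.
apply: ler_sum => i _; rewrite mxE mulrA ler_peMl -?expr2 ?sqr_ge0 //.
by rewrite -ler_pdivrMl // mulr1.
Qed.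

Arguments dnorm_le_wnorm {R M h b p} v.

Lemma wnorm_le (R : rcfType) (M : nat) (a K : R) (p : 'I_M -> R)
    (v : 'cV[R]_M) :
  (forall i, 0 <= p i <= a) -> 0 <= K -> (forall i, `|v i 0| <= K) ->
  wnorm p v <= Num.sqrt (M%:R * a) * K.
Proof.
move=> hp K_ge0 hv; rewrite -[X in _ * X](ger0_norm K_ge0) -sqrtr_sqr.
have a_ge0 : 0 <= M%:R * a.
  rewrite mulr_natl -[X in _ *+ X]card_ord -sumr_const; apply: sumr_ge0 => i _.
  by have /andP[p0 pa] := hp i; apply: le_trans pa.
rewrite -sqrtrM // ler_wsqrtr // -mulrA mulr_natl -[X in _ *+ X]card_ord.
rewrite -sumr_const; apply: ler_sum => i _; have /andP[p0 pa] := hp i.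
rewrite -expr2 ler_pM ?sqr_ge0 // -[v i 0 ^+ 2]real_normK ?num_real //.
by rewrite lerXn2r ?nnegrE.
Qed.

Lemma interior_vecD (R : realType) (M : nat) (v1 v2 : nat -> R) :
  interior_vec M v1 + interior_vec M v2 = interior_vec M (fun i => v1 i + v2 i).
Proof. by apply/matrixP => i j; rewrite !mxE. Qed.

(** The exact solution solves the scheme up to the truncation error, by the
    very definition of the latter. *)
Lemma trunc_error_vec (R : realType) (xL xR T alpha : R) (d : R -> R)
    (f u : R -> R -> R) (M N n : nat) :
  let V k := interior_vec M (fun i => u (xgrid xL xR M i) (tgrid T N k)) in
  u xR (tgrid T N n.-1) = 0 -> u xR (tgrid T N n) = 0 ->
  (tstep T N)^-1 *: (V n - V n.-1) =
    (2 * hstep xL xR M `^ alpha)^-1 *: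
      (Dmx xL xR d M *m Gmx alpha M *m (V n.-1 + V n))
    + fvec xL xR T f M N n
    + interior_vec M (fun i => trunc_error xL xR T alpha d f u M N i n).
Proof.
move=> V u0 u1.
have xR_grid : xgrid xL xR M M.+1 = xR.
  by rewrite /xgrid /hstep mulrC divfK ?pnatr_eq0 // addrC subrK.
apply/matrixP => i j; rewrite (ord1 j) {j} interior_vecD -mulmxA mul_diag_mx.
rewrite mxE [RHS]mxE [X in _ = X + _]mxE [X in _ = X + _ + _]mxE.
rewrite [X in _ = _ * X + _ + _]mxE Gmx_mul; last by rewrite xR_grid u0 u1 addr0.
by rewrite !mxE /trunc_error; ring.
Qed.

(** Linearity of the scheme: the source terms cancel in the difference of the
    equations of the exact and of the discrete solution. *)
Lemma grid_error_step (R : realType) (xL xR T alpha : R) (d : R -> R)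
    (f u : R -> R -> R) (phi : R -> R) (M N : nat) (U : nat -> nat -> R) n :
  0 < tstep T N -> (1 <= n <= N)%N ->
  u xR (tgrid T N n.-1) = 0 -> u xR (tgrid T N n) = 0 ->
  scheme_solution xL xR T alpha d f phi M N U ->
  let e k := interior_vec M (grid_error xL xR T u M N U k) in
  e n - e n.-1 = tstep T N *:
   ((2 * hstep xL xR M `^ alpha)^-1 *:
      (Dmx xL xR d M *m Gmx alpha M *m (e n.-1 + e n))
    + interior_vec M (fun i => trunc_error xL xR T alpha d f u M N i n)).
Proof.
move=> tau_gt0 nN u0 u1 [step _ _] e.
pose V k := interior_vec M (fun i => u (xgrid xL xR M i) (tgrid T N k)).
have eE k : e k = V k - interior_vec M (U k) by apply/matrixP => i j; rewrite !mxE.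
have exact := trunc_error_vec _ _ _ _ alpha d f _ M _ _ u0 u1.
apply: (@scalerI _ _ (tstep T N)^-1); first by rewrite invr_eq0 gt_eqF.
rewrite scalerA mulVf ?gt_eqF // scale1r.
have -> : e n - e n.-1
    = (V n - V n.-1) - (interior_vec M (U n) - interior_vec M (U n.-1)).
  by rewrite !eE [- (V n.-1 - _)]opprD addrACA -opprD.
have -> : e n.-1 + e n
    = (V n.-1 + V n) - (interior_vec M (U n.-1) + interior_vec M (U n)).
  by rewrite !eE opprD addrACA.
rewrite scalerBr [X in X - _]exact (step _ nN) mulmxBr (scalerBr (2 * _)^-1) -/V.
by rewrite [X in X - _]addrAC opprD addrACA subrr addr0 addrAC.
Qed.

Arguments grid_error_step {R xL xR T alpha d f u phi M N U n}.

Theorem theorem2p2 (R : realType) (xL xR T alpha : R)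
  (hx : xL < xR) (hT : 0 < T) (halpha : 1 < alpha < 2)
  (d : R -> R) (dm dp : R) (hdm : 0 < dm)
  (hd : forall x : R, xL <= x <= xR -> dm <= d x <= dp)
  (f u : R -> R -> R) (phi : R -> R)
  (hu : exact_solution xL xR T alpha d f u phi)
  (c1 : R) (hc1 : 0 < c1)
  (htrunc : forall M N : nat, (0 < M)%N -> (0 < N)%N ->
     forall i n : nat, (1 <= i <= M)%N -> (1 <= n <= N)%N ->
     `|trunc_error xL xR T alpha d f u M N i n|
       <= c1 * (tstep T N ^+ 2 + hstep xL xR M ^+ 2)) :
  exists2 c2 : R, 0 < c2 &
    forall M N : nat, (0 < M)%N -> (0 < N)%N ->
    forall U : nat -> nat -> R,
      scheme_solution xL xR T alpha d f phi M N U ->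
    forall n : nat, (n <= N)%N ->
      dnorm (hstep xL xR M) (interior_vec M (grid_error xL xR T u M N U n))
        <= c2 * (tstep T N ^+ 2 + hstep xL xR M ^+ 2).
Proof.
have /andP[d1 d2] : dm <= d xL <= dp by apply: hd; rewrite lexx ltW.
have dp_gt0 : 0 < dp by apply: lt_le_trans (le_trans d1 d2).
have L_gt0 : 0 < xR - xL by rewrite subr_gt0.
have [_ u_bdry u_init] := hu.
(* T and c1 come from summing over the time steps, xR - xL from M h <= xR - xL,
   and dp / dm from the passage between the two norms. *)
exists (Num.sqrt ((xR - xL) * dp / dm) * T * c1).
  by rewrite !mulr_gt0 // sqrtr_gt0 divr_gt0 // mulr_gt0.
move=> M N M_gt0 N_gt0 U schemeU n nN.
set h := hstep xL xR M; set tau := tstep T N.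
have tau_gt0 : 0 < tau by rewrite divr_gt0 // ltr0n.
have h_gt0 : 0 < h by rewrite divr_gt0.
have tgrid_in k : (k <= N)%N -> 0 <= tgrid T N k <= T.
  move=> kN; rewrite /tgrid mulr_ge0 ?(ltW tau_gt0) //=.
  by rewrite /tstep mulrA ler_pdivrMr ?ltr0n // mulrC ler_wpM2l ?ler_nat // ltW.
have grid_in i : (i <= M.+1)%N -> xL <= xgrid xL xR M i <= xR.
  move=> iM; rewrite /xgrid lerDl mulr_ge0 ?(ltW h_gt0) //= -lerBrDl.
  by rewrite /hstep mulrA ler_pdivrMr ?ltr0n // mulrC ler_wpM2l ?ler_nat // ltW.
pose e k := interior_vec M (grid_error xL xR T u M N U k).
pose dv : 'rV[R]_M := \row_(i < M) d (xgrid xL xR M i.+1).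
have dvP i : dm <= dv 0 i <= dp.
  by rewrite mxE; apply/hd/grid_in; rewrite ltnW // ltnS.
have dv_gt0 i : 0 < dv 0 i by have /andP[+ _] := dvP i; apply: lt_le_trans.
pose p i := (dv 0 i)^-1.
set K := c1 * (tau ^+ 2 + h ^+ 2).
have K_ge0 : 0 <= K by rewrite mulr_ge0 ?addr_ge0 ?sqr_ge0 // ltW.
set rho := Num.sqrt (M%:R * dm^-1) * K.
have growth k : (k <= N)%N -> wnorm p (e k) <= k%:R * (tau * rho).
  elim: k => [_|k IH kN].
    have -> : e 0 = 0.
      have [_ U0 _] := schemeU.
      apply/matrixP => i j; have iM : (i.+1 <= M.+1)%N by rewrite ltnW // ltnS.
      by rewrite !mxE /grid_error /tgrid mul0r U0 // u_init ?subrr ?grid_in.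
    rewrite mul0r /wnorm /wdot big1 ?sqrtr0 // => i _.
    by rewrite !mxE mul0r mulr0.
  have kN' := ltnW kN.
  have [[_ u0] [_ u1]] := (u_bdry _ (tgrid_in k kN'), u_bdry _ (tgrid_in k.+1 kN)).
  have kappa_ge0 : 0 <= (2 * h `^ alpha)^-1 by rewrite invr_ge0 mulr_ge0 ?powR_ge0.
  have step := grid_error_step (n := k.+1) tau_gt0 kN u0 u1 schemeU.
  apply: le_trans (crank_nicolson_stable (Gmx_le0 halpha (M := M)) dv_gt0
    (ltW tau_gt0) kappa_ge0 step) _.
  rewrite -[k.+1%:R]natr1 mulrDl mul1r lerD ?IH //.
  rewrite ler_wpM2l ?(ltW tau_gt0) //; apply: wnorm_le => // i.
    have /andP[dmi _] := dvP i.
    by rewrite /p invr_ge0 (ltW (dv_gt0 i)) lef_pV2 ?posrE.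
  by rewrite mxE htrunc //= ltn_ord.
have p_ge i : dp^-1 <= p i.
  by have /andP[_ dip] := dvP i; rewrite lef_pV2 ?posrE.
apply: le_trans (dnorm_le_wnorm _ (ltW h_gt0) dp_gt0 p_ge) _.
have ntau : n%:R * tau <= T by have /andP[] := tgrid_in n nN.
have hM : h * M%:R <= xR - xL.
  by rewrite mulrAC ler_pdivrMr ?ltr0n // ler_wpM2l ?ler_nat // ltW.
have rho_ge0 : 0 <= rho by rewrite mulr_ge0 ?sqrtr_ge0.
apply: (@le_trans _ _ (Num.sqrt (h * dp) * (T * rho))).
  rewrite ler_wpM2l ?sqrtr_ge0 //; apply: le_trans (growth n nN) _.
  by rewrite mulrA ler_wpM2r.
have -> : Num.sqrt (h * dp) * (T * rho)
    = Num.sqrt (h * M%:R * dp / dm) * T * K.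
  have -> : h * M%:R * dp / dm = h * dp * (M%:R / dm) by ring.
  by rewrite [in RHS]sqrtrM ?mulr_ge0 ?ltW // /rho; ring.
rewrite -[leRHS]mulrA -/K !ler_wpM2r ?(ltW hT) // ler_wsqrtr //.
by rewrite !ler_wpM2r ?invr_ge0 ?(ltW hdm) ?(ltW dp_gt0).
Qed.
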